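(* Let $g>0$, $\epsilon>0$, $h_\star>0$, $u_\star\in\mathbb{R}$, and let $h,u:\mathbb{R}\to\mathbb{R}$ satisfy $h\ge 0$ and $(h-h_\star,\,u-u_\star)\in H^1(\mathbb{R})$. Define $$E_\star=\int_{\mathbb{R}} \tfrac12 h(u-u_\star)^2+\tfrac12 g(h-h_\star)^2+\tfrac12\epsilon\left(h^3u_x^2+gh^2h_x^2\right)dx .$$ Then: (a) For all $x\in\mathbb{R}$, $$E_\star\ \ge\ \frac{g\sqrt{\epsilon}}{3}\,(h(x)-h_\star)^2\,(2h(x)+h_\star).$$ (b) If $E_\star<\frac13 g\sqrt{\epsilon}\,h_\star^3$, then $h(x)\ge h_E>0$ for all $x\in\mathbb{R}$, where $h_E$ is the unique solution in $(0,h_\star]$ of $$E_\star=\frac{g\sqrt{\epsilon}}{3}\,(h_E-h_\star)^2\,(2h_E+h_\star).$$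
   Context: $H^1(\mathbb{R})$ is the usual Sobolev space; functions in it are identified with their continuous representatives. $h$ represents a fluid depth, $u$ a horizontal velocity, $g$ the gravitational constant and $\epsilon$ a dimensionless parameter. *)

(* Defs.v *)
From mathcomp Require Import all_boot all_order all_algebra.
From mathcomp Require Import all_classical all_reals all_analysis.
Import Order.TTheory GRing.Theory Num.Theory.
Import numFieldNormedType.Exports.

Set Implicit Arguments.
Unset Strict Implicit.
Unset Printing Implicit Defensive.

Local Open Scope classical_set_scope.
Local Open Scope ring_scope.

Definition smooth (R : realType) (f : R -> R) : Prop :=
  forall (n : nat) (x : R), derivable (derive1n n f) x 1.

Definition compactly_supported (R : realType) (f : R -> R) : Prop :=
  compact (closure [set x | f x != 0]).

Definition test_function (R : realType) (phi : R -> R) : Prop :=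
  smooth phi /\ compactly_supported phi.

Definition weak_derivative (R : realType) (f df : R -> R) : Prop :=
  [/\ locally_integrable [set: R] f,
      locally_integrable [set: R] df &
      forall phi : R -> R, test_function phi ->
        \int[lebesgue_measure]_(x in [set: R]) (f x * derive1 phi x) =
        - \int[lebesgue_measure]_(x in [set: R]) (df x * phi x)].

(* L^2 membership is that of a function, not of an a.e. class: the continuous
   representative is selected by a separate continuity hypothesis. Measurability
   of [f] and [df] is Borel; every L^2 class has a Borel representative. *)
Definition sobolev_H1 (R : realType) (f : R -> R) : Prop :=
  f \in Lfun (@lebesgue_measure R) 2%:E /\
  exists2 df : R -> R,
    weak_derivative f df & df \in Lfun (@lebesgue_measure R) 2%:E.

(* [hx] and [ux] stand for weak derivatives of [h] and [u]. These are unique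
   almost everywhere, so the value does not depend on their choice. When
   [h - hs] and [u - us] are in H^1, h is bounded, the integrand is integrable
   and the real-valued integral is the genuine one. *)
Definition energy (R : realType) (g eps hs us : R) (h u hx ux : R -> R) : R :=
  \int[lebesgue_measure]_(x in [set: R])
    (2^-1 * h x * (u x - us) ^+ 2 + 2^-1 * g * (h x - hs) ^+ 2 +
     2^-1 * eps * (h x ^+ 3 * ux x ^+ 2 + g * h x ^+ 2 * hx x ^+ 2)).

Definition depth_bound (R : realType) (g eps hs y : R) : R :=
  g * Num.sqrt eps / 3 * (y - hs) ^+ 2 * (2 * y + hs).

(* Main.v *)
Require Import Defs.
From mathcomp Require Import all_boot all_order all_algebra.
From mathcomp Require Import all_classical all_reals all_analysis.
From mathcomp Require Import measurable_realfun ring lra.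
Import Order.TTheory GRing.Theory Num.Theory.
Import numFieldNormedType.Exports.
Local Open Scope classical_set_scope.
Local Open Scope ring_scope.

Set Implicit Arguments.
Unset Strict Implicit.
Unset Printing Implicit Defensive.

(** Write G(y) = (y - hs)^2 (2 y + hs) / 6, the primitive of (y - hs) y that
    vanishes at hs.  By Young's inequality the energy density is at least
    g sqrt(eps) |h - hs| h |hx|, which is g sqrt(eps) times the speed at which
    G o h varies ([energy_density_ge]).  Since h - hs is square integrable,
    G o h gets arbitrarily close to 0 on both sides of any point x, so it has to
    vary by G(h(x)) on the left of x and once more on the right.  Hence
    E >= 2 g sqrt(eps) G(h(x)), which is (a).  As a function of the depth y in
    [0, hs] this lower bound decreases strictly from g sqrt(eps) hs^3 / 3 to 0,
    so the intermediate value theorem gives a unique hE, and a depth below hE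
    would contradict (a); this is (b).

    The work lies in the low regularity, hx and ux being only weak derivatives.
    Testing against smoothed indicators of ]a, b] shows that a continuous
    function with a weak derivative is the integral of it
    ([weak_derivative_increment]); the test functions are built from
    exp(-1/x).  The chain rule for G o h is needed only as an inequality, which
    follows from the mean value theorem on short segments
    ([primitive_comp_le]).

    The energy is a real-valued integral, which is 0 by convention when the
    integral is infinite, so (a) also rests on the integrability of the density.
    By the Lebesgue differentiation theorem hx and ux agree almost everywhere
    with the square integrable weak derivatives provided by H^1
    ([H1_weak_derivative_sqr]), and h is bounded ([primitive_sqr_bounded]). *)

(** * Smooth functions built from exp(-1/x) *)

Section SmoothFunctions.
Context {R : realType}.
Implicit Types (f g : R -> R) (P : {poly R}).

Lemma is_derive_derive1 f (df : R -> R) :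
  (forall x : R, is_derive x (1 : R) f (df x)) -> derive1 f = df.
Proof. by move=> fdf; apply/funext => x; rewrite derive1E; apply: derive_val. Qed.

(** A class of functions closed under differentiation consists of smooth
    functions; this replaces Leibniz and chain rules for higher derivatives. *)
Lemma smooth_coind (C : (R -> R) -> Prop) :
  (forall f, C f -> exists2 df, C df & forall x : R, is_derive x (1 : R) f (df x)) ->
  forall f, C f -> smooth f.
Proof.
move=> Cder f Cf n x.
have [df _ dfP] : exists2 df, C df & forall y : R, is_derive y (1 : R) (derive1n n f) (df y).
  suff : C (derive1n n f) by exact: Cder.
  elim: n => [//|n /Cder [df Cdf dfP]].
  by rewrite derive1nS (is_derive_derive1 dfP).
by have [] := dfP x.
Qed.

Lemma smooth_is_derive f (x : R) : smooth f -> is_derive x (1 : R) f (derive1 f x).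
Proof. by move=> /(_ 0%N x) fd; rewrite derive1E; exact/derivableP. Qed.

Lemma smooth_derive1 f : smooth f -> smooth (derive1 f).
Proof. by move=> fS n x; rewrite -derive1Sn; exact: fS. Qed.

Lemma is_derive_continuous f (df : R -> R) :
  (forall x : R, is_derive x (1 : R) f (df x)) -> continuous f.
Proof.
move=> fdf x; apply/differentiable_continuous/derivable1_diffP.
by have [] := fdf x.
Qed.

Lemma smooth_continuous f : smooth f -> continuous f.
Proof. by move=> fS; apply: is_derive_continuous => x; exact: smooth_is_derive. Qed.

Lemma is_derive_quadratic0 f (C : R) :
  (forall x, `|f x| <= C * x ^+ 2) -> is_derive (0 : R) (1 : R) f 0.
Proof.
move=> fC.
have f0 : f 0 = 0.
  by apply/normr0_eq0/le_anti; rewrite normr_ge0 andbT (le_trans (fC 0))// expr0n mulr0.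
have C0 : 0 <= C by have := le_trans (normr_ge0 _) (fC 1); rewrite expr1n mulr1.
have lim : h^-1 *: (f (h *: 1 + 0) - f 0) @[h --> (0 : R)^'] --> (0 : R).
  apply/cvgr0Pnorm_le => e e0; near=> h.
  have h0 : h != 0 by near: h; exact: nbhs_dnbhs_neq.
  rewrite f0 subr0 addr0 [h *: 1]mulr1 normrM normfV ler_pdivrMl ?normr_gt0//.
  rewrite (le_trans (fC h))// -real_normK ?num_real// expr2 mulrCA.
  rewrite ler_wpM2l//.
  have : `|h| <= e / (C + 1).
    near: h; apply: dnbhs0_le; rewrite divr_gt0// ltr_wpDl//.
  rewrite ler_pdivlMr ?ltr_wpDl// mulrDr mulr1 mulrC.
  by apply: le_trans; rewrite lerDl.
by split; [apply/cvg_ex; exists 0|apply/cvg_lim].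
Unshelve. all: by end_near. Qed.

(** Keeping the polynomial factor general makes the family closed under
    differentiation; P = 1 is the usual flat function exp(-1/x). *)
Definition flat P (x : R) : R :=
  if 0 < x then P.[x^-1] * expR (- x^-1) else 0.

(** Each monomial t^i of P, with t = 1/x, is controlled by the term of degree
    i + 2 of the series of exp(t); the two spare powers of t give x^2. *)
Lemma flat_quadratic P : exists C : R, forall x, `|flat P x| <= C * x ^+ 2.
Proof.
exists (\sum_(i < size P) `|P`_i| * (i.+2)`!%:R) => x.
have C0 : 0 <= \sum_(i < size P) `|P`_i| * (i.+2)`!%:R.
  by apply: sumr_ge0 => i _; rewrite mulr_ge0.
rewrite /flat; case: ifPn => [x0|_]; last by rewrite normr0 mulr_ge0 ?sqr_ge0.
rewrite normrM expRN (ger0_norm (_ : 0 <= (expR _)^-1)) ?invr_ge0 ?expR_ge0//.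
rewrite ler_pdivrMr ?expR_gt0// horner_coef (le_trans (ler_norm_sum _ _ _))//.
rewrite -mulrA mulr_suml; apply: ler_sum => i _.
rewrite normrM -[leRHS]mulrA ler_wpM2l// normrX.
rewrite gtr0_norm ?invr_gt0//.
have /(expR_ge1Dxn i.+1) : 0 <= x^-1 by rewrite invr_ge0 ltW.
move=> H; have {}H : x^-1 ^+ i.+2 <= i.+2`!%:R * expR x^-1.
  rewrite -ler_pdivrMl ?ltr0n ?fact_gt0// mulrC (le_trans _ H)// lerDr//.
have -> : x^-1 ^+ i = x ^+ 2 * x^-1 ^+ i.+2.
  by rewrite -(addn2 i) exprD mulrCA -exprMn mulfV ?gt_eqF// expr1n mulr1.
by rewrite [leRHS]mulrCA ler_wpM2l// sqr_ge0.
Qed.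

Lemma is_derive_flat P x : is_derive (x : R) (1 : R) (flat P) (flat ('X^2 * (P - P^`())) x).
Proof.
have [x0|x0|->] := ltgtP x 0.
- rewrite [X in is_derive _ _ _ X](_ : _ = 0); last first.
    by rewrite /flat ltNge ltW.
  apply: (@near_eq_is_derive _ _ _ (cst 0)).
  near=> y; rewrite /flat ltNge ifN// negbK ltW//; near: y.
  exact: lt_nbhsl.
- rewrite [X in is_derive _ _ _ X]/flat x0.
  apply: (@near_eq_is_derive R R R (fun y : R => P.[y^-1] * expR (- y^-1))).
    near=> y; rewrite /flat ifT//; near: y; exact: lt_nbhsr.
  have xN0 : x != 0 by rewrite gt_eqF.
  have dV : is_derive (x : R) (1 : R) (fun y : R => y^-1) (- x ^- 2 *: 1).
    exact: is_deriveV.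
  have dN : is_derive (x : R) (1 : R) (fun y : R => - y^-1) (- (- x ^- 2 *: 1)).
    exact: is_deriveN.
  have dE := @is_derive1_comp _ expR (fun y : R => - y^-1) _ _ _ (is_derive_expR _) dN.
  have dP := @is_derive1_comp _ (horner P) (fun y : R => y^-1) _ _ _ (is_derive_poly _ _) dV.
  apply: is_derive_eq.
  rewrite /GRing.scale/= !hornerE/= exprVn; ring.
- rewrite [X in is_derive _ _ _ X]/flat ltxx.
  by have [C /is_derive_quadratic0] := flat_quadratic P.
Unshelve. all: by end_near. Qed.

(** The operations needed to build the cutoffs below.  The class is stable under
    differentiation, so [smooth_coind] applies to all its members at once. *)
Inductive smooth_expr : (R -> R) -> Prop :=
| SE_cst c : smooth_expr (cst c)
| SE_flat P : smooth_expr (flat P)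
| SE_add f g : smooth_expr f -> smooth_expr g -> smooth_expr (f \+ g)
| SE_mul f g : smooth_expr f -> smooth_expr g -> smooth_expr (f \* g)
| SE_inv f : smooth_expr f -> (forall x, f x != 0) ->
    smooth_expr (fun x => (f x)^-1)
| SE_affine f (k d : R) : smooth_expr f -> smooth_expr (fun x => f (k * x + d)).

Lemma smooth_expr_smooth f : smooth_expr f -> smooth f.
Proof.
apply: smooth_coind => {}f; elim=> {f}.
- by move=> c; exists (cst 0); [exact: SE_cst|move=> x; exact: is_derive_cst].
- move=> P; exists (flat ('X^2 * (P - P^`()))); first exact: SE_flat.
  exact: is_derive_flat.
- move=> f g _ [df ? fP] _ [dg ? gP]; exists (df \+ dg); first exact: SE_add.
  by move=> x; apply: is_deriveD.
- move=> f g ? [df ? fP] ? [dg ? gP]; exists ((f \* dg) \+ (g \* df)).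
    by apply: SE_add; exact: SE_mul.
  by move=> x; apply: is_deriveM.
- move=> f sf [df sdf fP] f0.
  exists ((cst (-1) \* df) \* ((fun x => (f x)^-1) \* (fun x => (f x)^-1))).
    by do ![apply: SE_mul|exact: SE_cst|exact: SE_inv|by []].
  move=> x; have := @is_deriveV _ f x _ _ (f0 x) (fP x).
  move=> /is_derive_eq; apply; rewrite /GRing.scale/=.
  by rewrite expr2 invfM mulN1r mulNr mulrC mulrN mulrC.
- move=> f k d sf [df sdf fP].
  exists (cst k \* (fun x => df (k * x + d))).
    by apply: SE_mul; [exact: SE_cst|exact: SE_affine].
  move=> x.
  have dA : is_derive (x : R) (1 : R) (fun y : R => k * y + d) k.
    by apply: is_derive_eq; rewrite addr0 /GRing.scale/= mulr1.
  have := @is_derive1_comp _ f (fun y : R => k * y + d) x _ _ (fP _) dA.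
  by move=> /is_derive_eq; apply; rewrite /= mulrC.
Qed.

End SmoothFunctions.

(** * Integrals over segments *)

Section IntegralHelpers.
Context {R : realType}.
Notation mu := (@lebesgue_measure R).
Implicit Types (f g h v : R -> R) (a b c d : R).

Lemma continuous_integrable_itv f a b :
  continuous f -> mu.-integrable `[a, b] (EFin \o f).
Proof.
move=> cf; apply: continuous_compact_integrable; first exact: segment_compact.
exact: continuous_subspaceT.
Qed.

Lemma locally_integrable_itv v a b :
  locally_integrable [set: R] v -> mu.-integrable `[a, b] (EFin \o v).
Proof.
move=> [mv _ iv]; apply/integrableP; split.
  by apply/measurable_EFinP; exact: measurable_funTS.
by apply: iv => //; exact: segment_compact.
Qed.

Lemma locally_integrable_norm v : locally_integrable [set: R] v ->
  locally_integrable [set: R] (fun x => `|v x|).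
Proof.
move=> [mv oT iv]; split => //; first exact: measurableT_comp.
by move=> C CT cC; under eq_integral do rewrite normr_id; exact: iv.
Qed.

Lemma integrable_continuousM_itv f v a b :
  continuous f -> locally_integrable [set: R] v ->
  mu.-integrable `[a, b] (EFin \o (f \* v)).
Proof.
move=> cf lv.
have cf' : {within `[a, b], continuous f} by exact: continuous_subspaceT.
apply: (@integrableMr _ _ _ mu _ _ f (EFin \o v)) => //.
- by apply: measurable_funTS; exact: continuous_measurable_fun.
- have /compact_bounded[M [Mr HM]] := continuous_compact cf' (@segment_compact _ a b).
  by exists M; split => // y My x xab; apply: HM => //; exists x.
- exact: locally_integrable_itv.
Qed.

Lemma Rintegral_support (A B : set R) f : A `<=` B ->
  (forall x, B x -> ~ A x -> f x = 0) ->
  \int[mu]_(x in B) f x = \int[mu]_(x in A) f x.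
Proof.
move=> AB f0; rewrite Rintegral_mkcond [RHS]Rintegral_mkcond.
congr Rintegral; apply/funext => x; rewrite !patchE.
case: ifPn => [xB|/negP xB]; case: ifPn => [xA|/negP xA] //.
  by apply: f0; [exact: set_mem|move/mem_set].
by exfalso; apply: xB; apply/mem_set/AB/set_mem.
Qed.

Lemma integrable_support (A : set (measurableTypeR R)) f : measurable A ->
  (forall x, ~ A x -> f x = 0) ->
  mu.-integrable A (EFin \o f) -> mu.-integrable [set: R] (EFin \o f).
Proof.
move=> mA f0 fi; have := (@integrable_mkcond _ _ _ mu A (EFin \o f) mA).1 fi.
congr (is_true (_.-integrable _ _)).
apply/funext => x; rewrite !patchE; case: ifPn => // /negP xA.
by rewrite /= f0// => /mem_set.
Qed.

Lemma Rintegral_derive f g a b : a <= b ->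
  (forall x, is_derive x (1 : R) f (g x)) -> continuous g ->
  \int[mu]_(x in `[a, b]) g x = f b - f a.
Proof.
move=> ab fg cg; have cf : continuous f := is_derive_continuous fg.
move: ab; rewrite le_eqVlt => /predU1P[->|ab].
  by rewrite set_itv1 Rintegral_set1 subrr.
rewrite /Rintegral (@continuous_FTC2 _ g f)//.
- exact: continuous_subspaceT.
- split=> [x _||]; first by have [] := fg x.
    by apply: cvg_at_right_filter; exact: cf.
  by apply: cvg_at_left_filter; exact: cf.
- by move=> x _; rewrite derive1E; apply: derive_val.
Qed.

Lemma Rintegral_itv_cat v a b c : a <= b -> b <= c ->
  mu.-integrable `[a, c] (EFin \o v) ->
  \int[mu]_(x in `[a, c]) v x =
  \int[mu]_(x in `[a, b]) v x + \int[mu]_(x in `[b, c]) v x.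
Proof.
move=> ab bc iv; have := @Rintegral_itvB _ _ _ _ b iv.
rewrite !bnd_simp => /(_ ab bc) /eqP; rewrite subr_eq => /eqP ->.
rewrite addrC; congr (_ + _); apply: Rintegral_itv_obnd_cbnd.
apply: (@integrableS _ _ _ mu `[a, c]) => //.
by apply: subset_itvr; rewrite bnd_simp.
Qed.

End IntegralHelpers.

(** * Smooth steps and their approximate identity *)

Section SmoothStep.
Context {R : realType}.
Notation mu := (@lebesgue_measure R).

Lemma flat1_gt0 (x : R) : 0 < x -> 0 < flat 1 x.
Proof. by move=> x0; rewrite /flat x0 hornerE mul1r expR_gt0. Qed.

Lemma flat_le0 P (x : R) : x <= 0 -> flat P x = 0.
Proof. by rewrite /flat ltNge => ->. Qed.

Lemma flat1_ge0 (x : R) : 0 <= flat 1 x.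
Proof. by have [/flat1_gt0/ltW//|/flat_le0->] := ltP 0 x. Qed.

Definition step (x : R) : R := flat 1 x / (flat 1 x + flat 1 (1 - x)).

Lemma step_denom_gt0 (x : R) : 0 < flat 1 x + flat 1 (1 - x).
Proof.
have [x0|x0] := ltP 0 x.
  by rewrite ltr_pwDl ?flat1_gt0 ?flat1_ge0.
by rewrite ltr_wpDl ?flat1_ge0// flat1_gt0// subr_gt0 (le_lt_trans x0).
Qed.

Lemma step_le0 (x : R) : x <= 0 -> step x = 0.
Proof. by move=> x0; rewrite /step flat_le0// mul0r. Qed.

Lemma step_ge1 (x : R) : 1 <= x -> step x = 1.
Proof.
move=> x1; have := step_denom_gt0 x; rewrite /step [flat 1 (1 - x)]flat_le0 ?subr_le0//.
by rewrite addr0 => /gt_eqF f0; rewrite divff// f0.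
Qed.

Lemma step_ge0 (x : R) : 0 <= step x.
Proof. by rewrite divr_ge0 ?flat1_ge0// ltW// step_denom_gt0. Qed.

Lemma step_le1 (x : R) : step x <= 1.
Proof. by rewrite ler_pdivrMr ?step_denom_gt0// mul1r lerDl flat1_ge0. Qed.

Lemma smooth_expr_step : smooth_expr step.
Proof.
have -> : step = flat 1 \* (fun x => (flat 1 x + flat 1 (-1 * x + 1))^-1).
  by apply/funext => x; rewrite /step /= mulN1r [- x + 1]addrC.
apply: SE_mul; first exact: SE_flat.
apply: (@SE_inv _ (flat 1 \+ (fun x => flat 1 (-1 * x + 1)))).
  by apply: SE_add; [|apply: (@SE_affine _ (flat 1))]; exact: SE_flat.
by move=> x; rewrite /= mulN1r [- x + 1]addrC gt_eqF// step_denom_gt0.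
Qed.

Lemma smooth_step : smooth step.
Proof. exact/smooth_expr_smooth/smooth_expr_step. Qed.

Lemma continuous_derive1_step : continuous (derive1 step).
Proof. exact/smooth_continuous/smooth_derive1/smooth_step. Qed.

Lemma derive1_step_lt0 (x : R) : x < 0 -> derive1 step x = 0.
Proof.
move=> x0; rewrite derive1E (@near_eq_derive _ _ _ _ (cst 0)) ?derive_cst//.
by near=> y; apply/step_le0/ltW; near: y; exact: lt_nbhsl.
Unshelve. all: by end_near. Qed.

Lemma derive1_step_gt1 (x : R) : 1 < x -> derive1 step x = 0.
Proof.
move=> x0; rewrite derive1E (@near_eq_derive R R R _ (cst (1 : R))) ?derive_cst//.
by near=> y; apply/step_ge1/ltW; near: y; exact: lt_nbhsr.
Unshelve. all: by end_near. Qed.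

Lemma derive1_step_bounded : exists2 M : R, 0 < M & forall x, `|derive1 step x| <= M.
Proof.
have c : {within `[0, 1], continuous (fun x : R => `|derive1 step x|)}.
  apply: continuous_subspaceT => x.
  by apply: continuous_comp; [exact: continuous_derive1_step|exact: norm_continuous].
have [y _ yM] := @EVT_max R _ 0 1 ler01 c.
exists (`|derive1 step y| + 1); first by rewrite ltr_wpDl.
move=> x; have [x0|x0] := ltP x 0; first by rewrite derive1_step_lt0// normr0 addr_ge0.
have [x1|x1] := ltP 1 x; first by rewrite derive1_step_gt1// normr0 addr_ge0.
by rewrite (le_trans (yM x _)) ?lerDl// in_itv/= x0.
Qed.

Definition ramp (a : R) (n : nat) (x : R) : R := step (n.+1%:R * (x - a)).
Definition bump (a : R) (n : nat) (x : R) : R :=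
  n.+1%:R * derive1 step (n.+1%:R * (x - a)).

Lemma is_derive_ramp a n (x : R) : is_derive x (1 : R) (ramp a n) (bump a n x).
Proof.
have dA : is_derive x (1 : R) (fun y : R => n.+1%:R * (y - a)) (n.+1%:R : R).
  by apply: is_derive_eq; rewrite /GRing.scale/= oppr0 addr0 mulr1.
have := @is_derive1_comp _ step _ x _ _ (smooth_is_derive _ smooth_step) dA.
by move=> /is_derive_eq; apply; rewrite /bump mulrC.
Qed.

Lemma smooth_expr_ramp a n : smooth_expr (ramp a n).
Proof.
rewrite (_ : ramp a n = fun x => step (n.+1%:R * x + - (n.+1%:R * a))).
  by apply: SE_affine; exact: smooth_expr_step.
by apply/funext => x; rewrite /ramp mulrBr.
Qed.

Lemma continuous_bump a n : continuous (bump a n).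
Proof.
have s := smooth_expr_smooth (smooth_expr_ramp a n).
have -> : bump a n = derive1 (ramp a n).
  by apply/funext => x; rewrite derive1E; apply/esym/derive_val/is_derive_ramp.
exact/smooth_continuous/smooth_derive1.
Qed.

Lemma ramp_le a n (x : R) : x <= a -> ramp a n x = 0.
Proof. by move=> xa; rewrite /ramp step_le0// mulr_ge0_le0// subr_le0. Qed.

Lemma ramp_ge a n (x : R) : a + n.+1%:R^-1 <= x -> ramp a n x = 1.
Proof. by move=> xa; rewrite /ramp step_ge1// -ler_pdivrMl// mulr1 lerBrDl. Qed.

Lemma bump_support a n (x : R) : ~ [set` `[a, a + n.+1%:R^-1]] x -> bump a n x = 0.
Proof.
move=> /negP; rewrite in_itv/= negb_and -!ltNge => /orP[xa|xa].
  by rewrite /bump derive1_step_lt0 ?mulr0// pmulr_rlt0// subr_lt0.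
by rewrite /bump derive1_step_gt1 ?mulr0// -ltr_pdivrMl// mulr1 ltrBrDl.
Qed.

Lemma inv_natS_le1 n : n.+1%:R^-1 <= 1 :> R.
Proof. by rewrite invf_le1 ?ltr0n// ler1n. Qed.

Lemma integrable_Mbump (h : R -> R) a n : continuous h ->
  mu.-integrable [set: R] (EFin \o (fun x => h x * bump a n x)).
Proof.
move=> ch; apply: (@integrable_support _ `[a, a + n.+1%:R^-1]).
- exact: measurable_itv.
- by move=> x /bump_support ->; rewrite mulr0.
- apply: continuous_integrable_itv => x.
  by apply: continuousM; [exact: ch|exact: continuous_bump].
Qed.

(** The bump at a has integral 1, being the derivative of a ramp from 0 to 1, and
    its support shrinks to a.  Its L^1 norm is at most a bound M of |step'|,
    since it is bounded by n.+1 M on a segment of length 1 / n.+1. *)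
Lemma bump_approx (h : R -> R) a : continuous h ->
  \int[mu]_(x in [set: R]) (h x * bump a n x) @[n --> \oo] --> h a.
Proof.
move=> ch; have [M M0 sM] := derive1_step_bounded.
apply/cvgrPdist_le => e e0.
have : \forall x \near a, `|h a - h x| <= e / M.
  by have /cvgrPdist_le := ch a; apply; rewrite divr_gt0.
move=> -[d /= d0 hd]; near=> n.
have nd : n.+1%:R^-1 < d.
  by near: n; exact: near_infty_natSinv_lt (PosNum d0).
set k : R := n.+1%:R; set D := `[a, a + k^-1]%classic.
have mD : measurable (D : set (measurableTypeR R)) by exact: measurable_itv.
have k0 : 0 < k by rewrite ltr0n.
have ak : a <= a + k^-1 by rewrite lerDl invr_ge0 ltW.
have cM (f : R -> R) : continuous f -> continuous (fun x => f x * bump a n x).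
  by move=> cf x; apply: continuousM; [exact: cf|exact: continuous_bump].
have iM (f : R -> R) : continuous f -> mu.-integrable D (EFin \o (fun x => f x * bump a n x)).
  by move=> cf; apply: continuous_integrable_itv; exact: cM.
have one : \int[mu]_(x in D) bump a n x = 1.
  have -> := Rintegral_derive ak (is_derive_ramp a n) (@continuous_bump a n).
  by rewrite ramp_ge// ramp_le// subr0.
rewrite (@Rintegral_support _ D) => [||x _ /bump_support ->]//; last by rewrite mulr0.
have -> : h a - \int[mu]_(x in D) (h x * bump a n x) =
    \int[mu]_(x in D) ((h a - h x) * bump a n x).
  under [RHS]eq_Rintegral do rewrite mulrBl.
  rewrite RintegralB//; last 2 first.
  - by apply: (iM (cst (h a))) => ?; exact: cvg_cst.
  - exact: iM.
  rewrite RintegralZl// ?one ?mulr1//.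
  by apply: continuous_integrable_itv; exact: continuous_bump.
have iD : mu.-integrable D (EFin \o (fun x => (h a - h x) * bump a n x)).
  by apply: iM => x; apply: continuousB; [exact: cvg_cst|exact: ch].
rewrite (le_trans (le_normr_Rintegral _ iD))//.
have -> : e = \int[mu]_(x in D) (cst (e * k) x).
  rewrite Rintegral_cst//= /D lebesgue_measure_itv/= lte_fin ltrDl invr_gt0 k0/=.
  by rewrite addrAC subrr add0r mulfK// gt_eqF.
apply: le_Rintegral => //.
- exact: (integrable_norm iD).
- by apply: continuous_integrable_itv => ?; exact: cvg_cst.
- move=> x; rewrite /D/= in_itv/= => /andP[ax xa].
  have -> : e * k = e / M * (k * M) by field; rewrite gt_eqF.
  rewrite normrM.
  apply: ler_pM => //.
    apply: hd => /=; rewrite ltr_norml; apply/andP; split; last first.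
      by rewrite (le_lt_trans _ d0)// subr_le0.
    by rewrite ltrNl opprB ltrBlDl (le_lt_trans xa)// ltrD2l.
  by rewrite /bump normrM gtr0_norm// ler_wpM2l// ltW.
Unshelve. all: by end_near. Qed.

End SmoothStep.

(** * Continuous functions are integrals of their weak derivatives *)

Section WeakDerivative.
Context {R : realType}.
Notation mu := (@lebesgue_measure R).
Implicit Types (h v : R -> R) (a b : R).

(** A smoothed indicator of ]a, b]. *)
Definition plateau a b n (x : R) : R := ramp a n x - ramp b n x.

Lemma is_derive_plateau a b n (x : R) :
  is_derive x (1 : R) (plateau a b n) (bump a n x - bump b n x).
Proof.
exact: (@is_deriveB R R R (ramp a n) (ramp b n) x 1 _ _
  (is_derive_ramp a n x) (is_derive_ramp b n x)).
Qed.

Lemma plateau_support a b n (x : R) : a <= b -> ~ [set` `[a, b + 1]] x ->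
  plateau a b n x = 0.
Proof.
move=> ab /negP; rewrite in_itv/= negb_and -!ltNge /plateau => /orP[xa|xb].
  by rewrite !ramp_le ?subr0// ltW// (lt_le_trans xa).
have n1 := @inv_natS_le1 R n.
by rewrite !ramp_ge ?subrr// (le_trans _ (ltW xb))// lerD.
Qed.

Lemma plateau_norm_le1 a b n (x : R) : `|plateau a b n x| <= 1.
Proof.
rewrite /plateau /ramp; set s := step _; set t := step _.
have s0 : 0 <= s by exact: step_ge0.
have s1 : s <= 1 by exact: step_le1.
have t0 : 0 <= t by exact: step_ge0.
have t1 : t <= 1 by exact: step_le1.
by rewrite ler_norml; apply/andP; split; lra.
Qed.

Lemma test_function_plateau a b n : a <= b -> test_function (plateau a b n).
Proof.
move=> ab; split.
  apply: smooth_expr_smooth.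
  rewrite (_ : plateau a b n = ramp a n \+ (cst (-1) \* ramp b n)).
    by apply: SE_add; [|apply: SE_mul; first exact: SE_cst];
       exact: smooth_expr_ramp.
  by apply/funext => x; rewrite /plateau /= mulN1r.
have cl : closed [set` `[a, b + 1]] by exact: interval_closed.
rewrite /compactly_supported; apply: (@subclosed_compact _ _ [set` `[a, b + 1]]).
- exact: closed_closure.
- exact: segment_compact.
rewrite [X in _ `<=` X](closure_id _).1//; apply: closureS => x /= /eqP px.
by apply: contrapT => /(plateau_support n ab).
Qed.

Lemma ramp_cvg a (x : R) : ramp a n x @[n --> \oo] --> (\1_`]a, +oo[ x : R).
Proof.
rewrite indicE; have [xa|ax] := leP x a.
  rewrite memNset => [|/=]; last by rewrite in_itv/= andbT ltNge xa.
  by under eq_fun do rewrite ramp_le//; exact: cvg_cst.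
rewrite mem_set/=; last by rewrite in_itv/= andbT.
have xa0 : 0 < x - a by rewrite subr_gt0.
apply: cvg_near_cst; near=> n; apply: ramp_ge; rewrite -lerBrDl ltW//.
by near: n; exact: near_infty_natSinv_lt (PosNum xa0).
Unshelve. all: by end_near. Qed.

(** Convergence holds at every point, endpoints included, because each ramp is
    still 0 at its foot. *)
Lemma plateau_cvg a b (x : R) : a <= b ->
  plateau a b n x @[n --> \oo] --> (\1_`]a, b] x : R).
Proof.
move=> ab.
rewrite (_ : \1_`]a, b] x = \1_`]a, +oo[ x - \1_`]b, +oo[ x).
  by apply: cvgB; exact: ramp_cvg.
rewrite !indicE /= !mem_setE !in_itv/= !andbT.
have [xb|bx] := leP x b; first by rewrite andbT subr0.
by rewrite andbF (le_lt_trans ab bx) subrr.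
Qed.

(** In the weak derivative identity tested on [plateau a b n], the left side
    tends to h a - h b because the derivative of the plateau is a bump at a minus
    a bump at b; the right side converges by dominated convergence. *)
Lemma weak_derivative_increment h v a b : a <= b -> continuous h ->
  weak_derivative h v -> h b - h a = \int[mu]_(x in `[a, b]) v x.
Proof.
move=> ab ch [_ lv hv]; set D := `[a, b + 1]%classic.
have mD : measurable (D : set (measurableTypeR R)) by exact: measurable_itv.
have mv : measurable_fun [set: R] v by case: lv.
have lhs : \int[mu]_(x in [set: R]) (h x * derive1 (plateau a b n) x)
    @[n --> \oo] --> h a - h b.
  rewrite (_ : (fun n => _) = (fun n =>
      \int[mu]_(x in [set: R]) (h x * bump a n x) -
      \int[mu]_(x in [set: R]) (h x * bump b n x))).
    by apply: cvgB; exact: bump_approx.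
  apply/funext => n; rewrite -RintegralB//; try exact: integrable_Mbump.
  apply: eq_Rintegral => x _; rewrite -mulrBr derive1E; congr (_ * _).
  exact/derive_val/is_derive_plateau.
have ivD : mu.-integrable [set: R] (EFin \o (fun x => `|v x| * \1_D x)).
  apply: (@integrable_support _ D) => //.
    by move=> x xD; rewrite indicE memNset// mulr0.
  have := integrable_norm (@locally_integrable_itv _ v a (b + 1) lv).
  apply: eq_integrable => // x xD.
  by rewrite /= indicE xD mulr1.
have rhs : \int[mu]_(x in [set: R]) (v x * plateau a b n x)
    @[n --> \oo] --> \int[mu]_(x in [set: R]) (v x * \1_`]a, b] x).
  have [] := @dominated_convergence _ _ _ mu [set: R] measurableT
    (fun n x => (v x * plateau a b n x)%:E)
    (fun x => (v x * \1_`]a, b] x)%:E)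
    (EFin \o (fun x => `|v x| * \1_D x)).
  - move=> n; apply/measurable_EFinP; apply: measurable_funM => //.
    apply: continuous_measurable_fun; apply: smooth_continuous.
    by have [] := test_function_plateau n ab.
  - apply/measurable_EFinP; apply: measurable_funM => //.
  - apply: aeW => x _; apply: cvg_EFin; first exact: nearW.
    by apply: cvgM; [exact: cvg_cst|exact: plateau_cvg].
  - exact: ivD.
  - apply: aeW => x n _ /=; rewrite lee_fin normrM ler_wpM2l//.
    rewrite indicE; have [/set_mem xD|/negP xD] := boolP (x \in D).
      exact: plateau_norm_le1.
    by rewrite plateau_support ?normr0// => /mem_set.
  - move=> ivab _ dcv; apply: fine_cvg; rewrite fineK//.
    exact: integrable_fin_num.
have eqn : \int[mu]_(x in [set: R]) (h x * derive1 (plateau a b n) x) @[n --> \oo] -->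
    - \int[mu]_(x in [set: R]) (v x * \1_`]a, b] x).
  rewrite (_ : (fun n => _) = (fun n => - \int[mu]_(x in [set: R]) (v x * plateau a b n x))).
    exact: cvgN.
  by apply/funext => n; apply: hv; exact: test_function_plateau.
have limE := cvg_unique (@Rhausdorff R) lhs eqn.
have -> : h b - h a = \int[mu]_(x in [set: R]) (v x * \1_`]a, b] x).
  by rewrite -[RHS]opprK -limE opprB.
have iab : mu.-integrable `]a, b] (EFin \o v).
  apply: (@integrableS _ _ _ mu `[a, b]) => //; last exact: locally_integrable_itv.
  by apply: subset_itvr; rewrite bnd_simp.
rewrite -Rintegral_itv_obnd_cbnd// [RHS]Rintegral_mkcond.
apply: eq_Rintegral => x _; rewrite patchE indicE.
by case: ifPn => /=; rewrite ?mulr1 ?mulr0.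
Qed.

End WeakDerivative.

(** * Functions that are integrals *)

Section Primitive.
Context {R : realType}.
Notation mu := (@lebesgue_measure R).
Implicit Types (f g h v w : R -> R) (a b c : R).

Definition is_primitive h v :=
  forall a b, a <= b -> h b - h a = \int[mu]_(x in `[a, b]) v x.

(** At a Lebesgue point x of f - g, the integral of f - g over [x - 1, y] has
    derivative f x - g x at y = x, and it vanishes identically. *)
Lemma ae_eq_Rintegral_itv f g :
  locally_integrable [set: R] f -> locally_integrable [set: R] g ->
  (forall a b, \int[mu]_(x in `[a, b]) f x = \int[mu]_(x in `[a, b]) g x) ->
  {ae mu, forall x, f x = g x}.
Proof.
move=> lf lg fg; pose d := f \- g.
have ld : locally_integrable [set: R] d by exact: locally_integrableB.
have d0 a b : \int[mu]_(x in `[a, b]) d x = 0.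
  by rewrite RintegralB ?fg ?subrr//; exact: locally_integrable_itv.
have := lebesgue_differentiation ld.
apply: filterS; first exact: (ae_filter_ringOfSetsType mu).
move=> x dx.
have x1 : x < x + 1 by rewrite ltrDl.
have ix := locally_integrable_itv (x - 1) (x + 1) ld.
have [|_] := FTC1_lebesgue_pt x1 ix _ dx; first by rewrite /= lte_fin gtrBl.
have -> : (fun y : R => \int[mu]_(t in `[x - 1, y]) d t) = cst 0.
  by apply/funext => y; exact: d0.
by rewrite derive1_cst => /esym/eqP; rewrite subr_eq0 => /eqP.
Qed.

Lemma ge0_Rintegral_itv_le f a b : (forall x, 0 <= f x) ->
  mu.-integrable [set: R] (EFin \o f) ->
  \int[mu]_(x in `[a, b]) f x <= \int[mu]_(x in [set: R]) f x.
Proof.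
move=> f0 fi; have fiab : mu.-integrable `[a, b] (EFin \o f).
  exact: (@integrableS _ _ _ mu [set: R]).
apply: fine_le; [exact: integrable_fin_num|exact: integrable_fin_num|].
apply: ge0_subset_integral => //.
- by case/integrableP : fi.
- by move=> x _; rewrite lee_fin.
Qed.

(** The point is the minimum of f on the segment. *)
Lemma exists_le_mean f a b : a < b -> continuous f -> (forall x, 0 <= f x) ->
  mu.-integrable [set: R] (EFin \o f) ->
  exists2 x, a <= x <= b & (b - a) * f x <= \int[mu]_(x in [set: R]) f x.
Proof.
move=> ab cf f0 fi.
have [x xab fx] := @EVT_min R f a b (ltW ab) (continuous_subspaceT cf).
exists x; first by move: xab; rewrite in_itv.
apply: le_trans (ge0_Rintegral_itv_le a b f0 fi).
have -> : (b - a) * f x = \int[mu]_(y in `[a, b]) (cst (f x) y).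
  rewrite Rintegral_cst//= lebesgue_measure_itv/= lte_fin ab/=.
  by rewrite mulrC.
apply: le_Rintegral => //.
- by apply: continuous_integrable_itv => ?; exact: cvg_cst.
- exact: continuous_integrable_itv.
Qed.

(** Within distance 1 of x some y has w(y)^2 bounded by the integral of w^2, and
    the increment from y to x is at most the integral of |v| <= 1 + v^2 over a
    segment of length at most 1. *)
Lemma primitive_sqr_bounded w v : continuous w ->
  locally_integrable [set: R] v -> is_primitive w v ->
  mu.-integrable [set: R] (EFin \o (fun x => w x ^+ 2)) ->
  mu.-integrable [set: R] (EFin \o (fun x => v x ^+ 2)) ->
  exists M, forall x, `|w x| <= M.
Proof.
move=> cw lv wv w2 v2.
set I := \int[mu]_(x in [set: R]) (w x ^+ 2).
set J := \int[mu]_(x in [set: R]) (v x ^+ 2).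
exists ((1 + I) + (1 + J)) => x.
have cw2 : continuous (fun x => w x ^+ 2).
  by move=> y; apply: continuousM; exact: cw.
have xx1 : x < x + 1 by rewrite ltrDl.
have [y /andP[xy yx1]] := exists_le_mean xx1 cw2 (fun y => sqr_ge0 (w y)) w2.
rewrite -/I addrAC subrr add0r mul1r => wyI.
have wy : `|w y| <= 1 + I.
  apply: (@le_trans _ _ (1 + w y ^+ 2)); last by rewrite lerD2l.
  rewrite -real_normK ?num_real//; have := normr_ge0 (w y).
  set t := `|w y| => t0; nra.
rewrite -(subrK (w y) (w x)) (le_trans (ler_normD _ _))// addrC lerD//.
have ixy := locally_integrable_itv x y lv.
rewrite distrC wv// (le_trans (le_normr_Rintegral _ ixy))//.
have v2xy : mu.-integrable `[x, y] (EFin \o (fun t => v t ^+ 2)).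
  exact: (@integrableS _ _ _ mu [set: R]).
have i1 : mu.-integrable `[x, y] (EFin \o cst (1 : R)).
  by apply: continuous_integrable_itv => ?; exact: cvg_cst.
apply: (@le_trans _ _ (\int[mu]_(t in `[x, y]) (cst 1 t + v t ^+ 2))).
  apply: le_Rintegral => //; first exact: (integrable_norm ixy).
    exact: (integrableD _ i1 v2xy).
  move=> t _ /=; rewrite -[leRHS]/(1 + v t ^+ 2) -real_normK ?num_real//.
  have := normr_ge0 (v t); set s := `|v t| => s0; nra.
rewrite RintegralD// lerD//; last first.
  by apply: ge0_Rintegral_itv_le => // t; exact: sqr_ge0.
rewrite Rintegral_cst//= lebesgue_measure_itv/= lte_fin mul1r.
by case: ifPn => _ //=; rewrite lerBlDl.
Qed.

(** Compactness of segments in the form of Cousin's lemma; the proof considers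
    the supremum of the points that can be reached from a. *)
Lemma segment_chaining (Q : R -> R -> Prop) :
  (forall x y z, x <= y -> y <= z -> Q x y -> Q y z -> Q x z) ->
  (forall x, exists2 d, 0 < d &
     forall y z, x - d < y -> y <= z -> z < x + d -> Q y z) ->
  forall a b, a <= b -> Q a b.
Proof.
move=> Qcat Qloc a b ab.
pose A := [set x | a <= x <= b /\ Q a x].
have Aa : A a.
  split; first by rewrite lexx.
  by have [d d0] := Qloc a; apply => //; rewrite ?ltrBlDr ltrDl.
have supA : has_sup A by split; [exists a|exists b => x [/andP[]]].
set s := sup A.
have as_ : a <= s by apply: ub_le_sup => //; case: supA.
have sb : s <= b by apply: ge_sup => [|x [/andP[]//]]; exists a.
have [d d0 Qd] := Qloc s.
have [x [/andP[ax xb] Qax] sx] := sup_adherent d0 supA.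
have xs : x <= s by apply: ub_le_sup; [case: supA|split => //; apply/andP].
have Qas z : s <= z -> z < s + d -> Q a z.
  move=> sz zd; apply: (Qcat _ x) => //; first exact: le_trans sz.
  by apply: Qd => //; exact: le_trans sz.
have [bd|db] := ltP b (s + d); first exact: Qas.
have : A (s + d / 2).
  split; first by apply/andP; split; [rewrite ler_wpDr// divr_ge0// ltW|lra].
  by apply: Qas; lra.
move=> /(ub_le_sup supA.2); rewrite -/s; lra.
Qed.

(** An inequality form of the chain rule G(h)' = K(h) v.  On a short segment the
    mean value theorem gives the increment of G o h as K(xi) times that of h,
    with xi so close to the values of h that |K(xi)| <= |K(h)| + c.  Such
    estimates add up over consecutive segments, and c is arbitrary. *)
Lemma primitive_comp_le h v (G K : R -> R) a b : continuous h ->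
  locally_integrable [set: R] v -> is_primitive h v ->
  (forall y : R, is_derive y (1 : R) G (K y)) -> continuous K -> a <= b ->
  `|G (h b) - G (h a)| <= \int[mu]_(x in `[a, b]) (`|K (h x)| * `|v x|).
Proof.
move=> ch lv hv dG cK ab.
have lnv := locally_integrable_norm lv.
have cG : continuous G := is_derive_continuous dG.
have cKh : continuous (fun x => `|K (h x)|).
  move=> x; apply: continuous_comp; last exact: norm_continuous.
  by apply: continuous_comp; [exact: ch|exact: cK].
have main c : 0 < c ->
    `|G (h b) - G (h a)| <= \int[mu]_(x in `[a, b]) ((`|K (h x)| + c) * `|v x|).
  move=> c0; move: ab.
  have cKc : continuous (fun x => `|K (h x)| + c).
    by move=> x; apply: cvgD; [exact: cKh|exact: cvg_cst].
  have im y z := @integrable_continuousM_itv R _ _ y z cKc lnv.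
  apply: (@segment_chaining (fun a b =>
      `|G (h b) - G (h a)| <= \int[mu]_(x in `[a, b]) ((`|K (h x)| + c) * `|v x|))).
    move=> x y z xy yz Gxy Gyz.
    rewrite (Rintegral_itv_cat xy yz (im x z)) (le_trans _ (lerD Gxy Gyz))//.
    have -> : G (h z) - G (h x) = (G (h y) - G (h x)) + (G (h z) - G (h y)) by ring.
    exact: ler_normD.
  (* on a neighbourhood of x, all values of K o h lie within c / 2 of K (h x) *)
  move=> x.
  have c20 : 0 < c / 2 by rewrite divr_gt0.
  have /cvgrPdist_lt /(_ _ c20) [e /= e0 Ke] := cK (h x).
  have /cvgrPdist_lt /(_ _ e0) [d /= d0 hd] := ch x.
  exists d => // y z xy yz zx.
  have near_x t : y <= t <= z -> ball (h x) e (h t).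
    move=> /andP[yt tz]; apply: hd => /=.
    by rewrite ltr_norml; apply/andP; split; lra.
  have hy : ball (h x) e (h y) by apply: near_x; rewrite lexx.
  have hz : ball (h x) e (h z) by apply: near_x; rewrite lexx andbT.
  have [xi xie ->] : exists2 xi, ball (h x) e xi &
      G (h z) - G (h y) = K xi * (h z - h y).
    move: (h y) (h z) hy hz => p q.
    wlog pq : p q / p <= q => [H|] hp hq.
      have [pq|/ltW qp] := leP p q; first exact: H.
      have [xi xie E] := H q p qp hq hp.
      by exists xi => //; rewrite -opprB E -mulrN opprB.
    have [xi] := @MVT_segment R G K p q pq (fun t _ => dG t) (continuous_subspaceT cG).
    rewrite in_itv/= => /andP[pxi xiq] E; exists xi => //.
    move: hp hq; rewrite /ball /= !ltr_norml => /andP[? ?] /andP[? ?].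
    by apply/andP; split; lra.
  rewrite normrM hv//.
  have ivyz := locally_integrable_itv y z lv.
  have inyz := locally_integrable_itv y z lnv.
  apply: (@le_trans _ _ (`|K xi| * \int[mu]_(t in `[y, z]) `|v t|)).
    by rewrite ler_wpM2l// le_normr_Rintegral.
  rewrite -RintegralZl//; apply: le_Rintegral => //.
    by apply: integrable_continuousM_itv => // ?; exact: cvg_cst.
  move=> t /=; rewrite in_itv/= => /near_x /Ke Kt; rewrite ler_wpM2r//.
  have : `|K (h x) - K (h t)| < c / 2 by exact: Kt.
  have : `|K (h x) - K xi| < c / 2 by exact: Ke.
  rewrite !ltr_norml => /andP[? ?] /andP[? ?]; rewrite ler_norml.
  have := ler_norm (K (h t)); have := ler_norm (- K (h t)); rewrite normrN.
  by move=> ? ?; apply/andP; split; lra.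
have iK := @integrable_continuousM_itv R _ _ a b cKh lnv.
have iv := locally_integrable_itv a b lnv.
apply/ler_addgt0Pr => e e0.
set J := \int[mu]_(x in `[a, b]) `|v x|.
have J0 : 0 <= J by apply: Rintegral_ge0.
have J1 : 0 < J + 1 by rewrite ltr_wpDl.
apply: (le_trans (main _ (divr_gt0 e0 J1))).
under eq_Rintegral do rewrite mulrDl.
rewrite RintegralD//; last first.
  by apply: integrable_continuousM_itv => // ?; exact: cvg_cst.
rewrite RintegralZl// lerD2l -/J mulrAC ler_pdivrMr// ler_wpM2l ?ltW//.
by rewrite ltrDl.
Qed.

End Primitive.

(** * The energy estimate *)

Section DepthBound.
Context {R : realType}.
Notation mu := (@lebesgue_measure R).
Implicit Types (h u v w hx ux : R -> R).

(** Both ux and the weak derivative supplied by H^1 integrate to the increments of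
    u, hence they agree almost everywhere. *)
Lemma H1_weak_derivative_sqr (u ux : R -> R) (us : R) : continuous u ->
  sobolev_H1 (fun x => u x - us) -> weak_derivative u ux ->
  mu.-integrable [set: R] (EFin \o (fun x => ux x ^+ 2)).
Proof.
move=> cu [_ [du wdu /Lfun2_integrable_sqr du2]] wux.
have cus : continuous (fun x => u x - us).
  by move=> x; apply: cvgB; [exact: cu|exact: cvg_cst].
have [_ lux _] := wux; have [_ ldu _] := wdu.
have duux : {ae mu, forall x, du x = ux x}.
  apply: ae_eq_Rintegral_itv => // a b; have [ab|ba] := leP a b.
    rewrite -(weak_derivative_increment ab cu wux).
    by rewrite -(weak_derivative_increment ab cus wdu); ring.
  by rewrite set_itv_ge ?bnd_simp -?ltNge// !Rintegral_set0.
have mux : measurable_fun [set: R] ux by case: lux.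
have mdu : measurable_fun [set: R] du by case: ldu.
apply/integrableP; split; first by apply/measurable_EFinP; exact: measurable_funX.
have /integrableP[_] := du2; apply: le_lt_trans.
rewrite (@ae_eq_integral _ _ _ mu [set: R] (fun x => `|(du x ^+ 2)%:E|)%E)//.
- by do 2 apply: measurableT_comp => //; exact: measurable_funX.
- by do 2 apply: measurableT_comp => //; exact: measurable_funX.
- apply: filterS duux; first exact: (ae_filter_ringOfSetsType mu).
  by move=> x /= ->.
Qed.

Lemma bounded_integrableM (f v : R -> R) (M : R) : continuous f ->
  (forall x, `|f x| <= M) -> mu.-integrable [set: R] (EFin \o v) ->
  mu.-integrable [set: R] (EFin \o (fun x => f x * v x)).
Proof.
move=> cf fM iv.
apply: (@integrableMr _ _ _ mu _ _ f (EFin \o v)) => //.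
  exact: continuous_measurable_fun.
exists M; split; first exact: num_real.
by move=> y My x _; rewrite /= (le_trans (fM x))// ltW.
Qed.

(** The primitive of (y - hs) y that vanishes at y = hs. *)
Definition depth_primitive (hs y : R) : R := (y - hs) ^+ 2 * (2 * y + hs) / 6.

Lemma is_derive_depth_primitive (hs y : R) :
  is_derive y (1 : R) (depth_primitive hs) ((y - hs) * y).
Proof.
rewrite /depth_primitive; apply: is_derive_eq.
by rewrite /GRing.scale/=; field.
Qed.

Lemma depth_boundE (g eps hs y : R) :
  depth_bound g eps hs y = 2 * (g * Num.sqrt eps * depth_primitive hs y).
Proof. by rewrite /depth_bound /depth_primitive; field. Qed.

Lemma depth_bound_decr (g eps hs y z : R) : 0 < g -> 0 < eps ->
  0 <= y -> y < z -> z <= hs -> depth_bound g eps hs z < depth_bound g eps hs y.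
Proof.
move=> g0 e0 y0 yz zhs; rewrite !depth_boundE ltr_pM2l// ltr_pM2l; last first.
  by rewrite mulr_gt0// sqrtr_gt0.
rewrite /depth_primitive ltr_pM2r ?invr_gt0// -subr_gt0.
have -> : (y - hs) ^+ 2 * (2 * y + hs) - (z - hs) ^+ 2 * (2 * z + hs) =
  (z - y) * ((3 * (hs - z) * (y + z)) + (z - y) * (z + 2 * y)) by ring.
rewrite mulr_gt0 ?subr_gt0// ltr_wpDl//.
  by rewrite !mulr_ge0 ?subr_ge0// addr_ge0// (le_trans y0)// ltW.
by rewrite mulr_gt0 ?subr_gt0// ltr_pwDl ?(le_lt_trans y0)// mulr_ge0.
Qed.

Lemma sqr_integrable_small w (x c : R) : continuous w ->
  mu.-integrable [set: R] (EFin \o (fun y => w y ^+ 2)) -> 0 < c ->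
  exists a b, [/\ a <= x, x <= b, w a ^+ 2 <= c & w b ^+ 2 <= c].
Proof.
move=> cw w2 c0; pose I := \int[mu]_(y in [set: R]) (w y ^+ 2).
have I_ge0 : 0 <= I by apply: Rintegral_ge0 => y _; exact: sqr_ge0.
(* the mean of w^2 over a segment of length N is below c *)
pose N := I / c + 1.
have N0 : 0 < N by rewrite /N ltr_wpDl// divr_ge0// ltW.
have cw2 : continuous (fun y => w y ^+ 2).
  by move=> y; apply: continuousM; exact: cw.
have small p q : q - p = N -> exists2 y, p <= y <= q & w y ^+ 2 <= c.
  move=> qpN; have pq : p < q by rewrite -subr_gt0 qpN.
  have [y ypq yI] := exists_le_mean pq cw2 (fun y => sqr_ge0 (w y)) w2.
  exists y => //; rewrite -(ler_pM2l N0) -qpN (le_trans yI)// qpN -/I.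
  by rewrite -ler_pdivrMr// lerDl.
have [|a /andP[_ ax] ac] := small (x - N) x; first by ring.
have [|b /andP[xb _] bc] := small x (x + N); first by ring.
by exists a, b.
Qed.

Definition energy_density (g eps hs us : R) h u hx ux (x : R) : R :=
  2^-1 * h x * (u x - us) ^+ 2 + 2^-1 * g * (h x - hs) ^+ 2 +
  2^-1 * eps * (h x ^+ 3 * ux x ^+ 2 + g * h x ^+ 2 * hx x ^+ 2).

Lemma energy_density_ge (g eps hs us : R) h u hx ux (x : R) :
  0 < g -> 0 < eps -> 0 <= h x ->
  g * Num.sqrt eps * (`|(h x - hs) * h x| * `|hx x|) <=
  energy_density g eps hs us h u hx ux x.
Proof.
move=> g_gt0 eps_gt0 hx_ge0; rewrite /energy_density; set s := Num.sqrt eps.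
have -> : eps = s ^+ 2 by rewrite sqr_sqrtr// ltW.
rewrite normrM (ger0_norm hx_ge0).
apply: (@le_trans _ _ (2^-1 * g * (h x - hs) ^+ 2 +
    2^-1 * s ^+ 2 * (g * h x ^+ 2 * hx x ^+ 2))); last first.
  rewrite -subr_ge0 (_ : _ - _ = 2^-1 * h x * (u x - us) ^+ 2 +
    2^-1 * s ^+ 2 * (h x ^+ 3 * ux x ^+ 2)); last by ring.
  apply: addr_ge0; apply: mulr_ge0; rewrite ?sqr_ge0//.
  - by rewrite mulr_ge0.
  - by apply: mulr_ge0; rewrite ?sqr_ge0.
  - by apply: mulr_ge0; rewrite ?sqr_ge0 ?exprn_ge0.
rewrite -[(h x - hs) ^+ 2]real_normK ?num_real//.
rewrite -[hx x ^+ 2]real_normK ?num_real// -subr_ge0.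
set p := `|h x - hs|; set q := `|hx x|.
(* Young's inequality: the difference is a square *)
have -> : 2^-1 * g * p ^+ 2 + 2^-1 * s ^+ 2 * (g * h x ^+ 2 * q ^+ 2) -
  g * s * (p * h x * q) = 2^-1 * g * (p - s * h x * q) ^+ 2 by field.
by apply: mulr_ge0; rewrite ?sqr_ge0// mulr_ge0// ltW.
Qed.

Lemma energy_density_ge0 (g eps hs us : R) h u hx ux (x : R) :
  0 < g -> 0 < eps -> 0 <= h x -> 0 <= energy_density g eps hs us h u hx ux x.
Proof.
move=> g0 eps0 hx0; apply: le_trans (energy_density_ge hs us u hx ux g0 eps0 hx0).
by apply: mulr_ge0; [rewrite mulr_ge0 ?sqrtr_ge0// ltW|exact: mulr_ge0].
Qed.

Lemma integrable_energy_density (g eps hs us M : R) h u hx ux :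
  continuous h -> (forall x, `|h x| <= M) ->
  mu.-integrable [set: R] (EFin \o (fun x => (h x - hs) ^+ 2)) ->
  mu.-integrable [set: R] (EFin \o (fun x => (u x - us) ^+ 2)) ->
  mu.-integrable [set: R] (EFin \o (fun x => hx x ^+ 2)) ->
  mu.-integrable [set: R] (EFin \o (fun x => ux x ^+ 2)) ->
  mu.-integrable [set: R] (EFin \o energy_density g eps hs us h u hx ux).
Proof.
move=> ch hM w2 uu2 hx2 ux2.
have ch2 : continuous (fun y => h y ^+ 2).
  by move=> y; apply: continuousM; exact: ch.
have ch3 : continuous (fun y => h y ^+ 3).
  by move=> y; apply: (@cvgM _ _ _ _ h (fun y => h y ^+ 2)); [exact: ch|exact: ch2].
have hnM n y : `|h y ^+ n| <= M ^+ n.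
  by rewrite normrX lerXn2r ?nnegrE ?(le_trans _ (hM y)).
have i1 := integrableZl measurableT 2^-1 (bounded_integrableM ch hM uu2).
have i2 := integrableZl measurableT (2^-1 * g) w2.
have i3 := integrableZl measurableT (2^-1 * eps)
  (bounded_integrableM ch3 (hnM 3%N) ux2).
have i4 := integrableZl measurableT (2^-1 * eps * g)
  (bounded_integrableM ch2 (hnM 2%N) hx2).
have := integrableD measurableT
  (integrableD measurableT (integrableD measurableT i1 i2) i3) i4.
apply: eq_integrable => // y _; rewrite /= -!EFinM -!EFinD; congr EFin.
by rewrite /energy_density; ring.
Qed.

(** With a on the left of x and b on its right where the primitive G of
    (y - hs) y is nearly 0 along h, [primitive_comp_le] on [a, x] and on [x, b]
    bounds 2 G(h x) by the integral of |h - hs| h |hx| over [a, b]. *)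
Lemma depth_bound_le_energy (g eps hs us : R) h u hx ux (x : R) :
  0 < g -> 0 < eps -> 0 < hs -> (forall x : R, 0 <= h x) ->
  continuous h -> continuous u ->
  sobolev_H1 (fun x : R => h x - hs) -> sobolev_H1 (fun x : R => u x - us) ->
  weak_derivative h hx -> weak_derivative u ux ->
  depth_bound g eps hs (h x) <= energy g eps hs us h u hx ux.
Proof.
move=> g_gt0 eps_gt0 hs_gt0 h_ge0 h_cont u_cont hH1 uH1 h_hx u_ux.
have hx2 := H1_weak_derivative_sqr h_cont hH1 h_hx.
have ux2 := H1_weak_derivative_sqr u_cont uH1 u_ux.
have w2 : mu.-integrable [set: R] (EFin \o (fun x => (h x - hs) ^+ 2)).
  by case: hH1 => /Lfun2_integrable_sqr.
have uu2 : mu.-integrable [set: R] (EFin \o (fun x => (u x - us) ^+ 2)).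
  by case: uH1 => /Lfun2_integrable_sqr.
have [_ lhx _] := h_hx.
have cw : continuous (fun x => h x - hs).
  by move=> y; apply: cvgB; [exact: h_cont|exact: cvg_cst].
have prim : is_primitive h hx.
  by move=> a b ab; exact: weak_derivative_increment.
have [M wM] : exists M, forall y, `|h y - hs| <= M.
  apply: (@primitive_sqr_bounded _ (fun y => h y - hs) hx) => //.
  by move=> a b ab; rewrite -prim//; ring.
have hM y : `|h y| <= M + hs.
  rewrite -[h y](subrK hs) (le_trans (ler_normD _ _))// (gtr0_norm hs_gt0).
  by rewrite lerD2r.
pose e := energy_density g eps hs us h u hx ux.
have ie : mu.-integrable [set: R] (EFin \o e).
  exact: (@integrable_energy_density g eps hs us (M + hs)).
have e_ge0 y : 0 <= e y by exact: energy_density_ge0.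
set s := Num.sqrt eps.
have s_gt0 : 0 < s by rewrite sqrtr_gt0.
have gs0 : 0 < g * s by rewrite mulr_gt0.
pose K y := (y - hs) * y.
have cK : continuous K.
  move=> y; apply: (@cvgM _ _ _ _ (fun y => y - hs) id); last exact: cvg_id.
  by apply: cvgB; [exact: cvg_id|exact: cvg_cst].
have cKh : continuous (fun y => `|K (h y)|).
  move=> y; apply: (@continuous_comp _ _ _ (K \o h) Num.norm).
    by apply: (@continuous_comp _ _ _ h K); [exact: h_cont|exact: cK].
  exact: norm_continuous.
have incr a b := @primitive_comp_le R _ _ _ _ a b h_cont lhx prim
  (is_derive_depth_primitive hs) cK.
set E := energy _ _ _ _ _ _ _ _.
have EE : E = \int[mu]_(y in [set: R]) e y by [].
pose G := depth_primitive hs.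
pose B := (2 * (M + hs) + hs) / 6.
have M_ge0 : 0 <= M by exact: le_trans (wM 0).
have B_ge0 : 0 <= B.
  by rewrite /B divr_ge0// addr_ge0 ?mulr_ge0 ?addr_ge0// ltW.
have GB y : G (h y) <= (h y - hs) ^+ 2 * B.
  rewrite /G /depth_primitive /B -mulrA ler_wpM2l ?sqr_ge0//.
  rewrite ler_pM2r ?invr_gt0// lerD2r ler_pM2l// (le_trans _ (hM y))//.
  exact: ler_norm.
rewrite depth_boundE; apply/ler_addgt0Pr => c c0.
pose c' := c / (2 * (g * s)).
have c'0 : 0 < c' by rewrite divr_gt0// mulr_gt0.
have B1 : 0 < B + 1 by rewrite ltr_wpDl.
have Gsmall y : (h y - hs) ^+ 2 <= c' / (B + 1) -> G (h y) <= c'.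
  move=> hy; rewrite (le_trans (GB y))// (le_trans (ler_wpM2r B_ge0 hy))//.
  by rewrite mulrAC ler_pdivrMr// ler_pM2l// lerDl.
have [a [b [ax xb /Gsmall Ga /Gsmall Gb]]] :=
  sqr_integrable_small x cw w2 (divr_gt0 c'0 B1).
set F := fun y => `|K (h y)| * `|hx y|.
have iF p q : mu.-integrable `[p, q] (EFin \o F).
  exact: integrable_continuousM_itv (locally_integrable_norm lhx).
have GE : 2 * G (h x) <= 2 * c' + \int[mu]_(y in `[a, b]) F y.
  rewrite (Rintegral_itv_cat ax xb (iF a b)).
  have := incr _ _ ax; have := incr _ _ xb; rewrite !ler_norml -/G -/F.
  move=> /andP[H1 _] /andP[_ H2]; lra.
have FE : g * s * \int[mu]_(y in `[a, b]) F y <= E.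
  rewrite -RintegralZl// EE.
  apply: le_trans (ge0_Rintegral_itv_le a b e_ge0 ie).
  apply: le_Rintegral => //.
  - exact: (integrableZl _ (g * s) (iF a b)).
  - exact: (@integrableS _ _ _ mu [set: R]).
  - by move=> y _; exact: energy_density_ge.
rewrite mulrCA -/G.
apply: (@le_trans _ _ (g * s * (2 * c' + \int[mu]_(y in `[a, b]) F y))).
  by rewrite ler_pM2l.
rewrite mulrDr addrC lerD// /c'.
have -> : g * s * (2 * (c / (2 * (g * s)))) = c by field; rewrite !gt_eqF.
by [].
Qed.

End DepthBound.

Unset Implicit Arguments.

Theorem proposition2p1 (R : realType) (g eps hs us : R) (h u hx ux : R -> R)
  (g_gt0 : 0 < g) (eps_gt0 : 0 < eps) (hs_gt0 : 0 < hs)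
  (h_ge0 : forall x : R, 0 <= h x)
  (h_cont : continuous h) (u_cont : continuous u)
  (hH1 : sobolev_H1 (fun x : R => h x - hs))
  (uH1 : sobolev_H1 (fun x : R => u x - us))
  (h_hx : weak_derivative h hx) (u_ux : weak_derivative u ux) :
  let E := energy g eps hs us h u hx ux in
  (forall x : R, depth_bound g eps hs (h x) <= E) /\
  (E < 3^-1 * g * Num.sqrt eps * hs ^+ 3 ->
   exists hE : R,
     unique (fun y : R => 0 < y <= hs /\ E = depth_bound g eps hs y) hE /\
     (forall x : R, hE <= h x /\ 0 < hE)).
Proof.
move=> E.
have boundE x : depth_bound g eps hs (h x) <= E by exact: depth_bound_le_energy.
split=> // EltE0.
have bound0 : depth_bound g eps hs 0 = 3^-1 * g * Num.sqrt eps * hs ^+ 3.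
  by rewrite /depth_bound; field.
have boundhs : depth_bound g eps hs hs = 0.
  by rewrite /depth_bound subrr expr0n/= mulr0 mul0r.
have E_ge0 : 0 <= E.
  apply: le_trans (boundE 0); rewrite /depth_bound; apply: mulr_ge0; last first.
    by apply: addr_ge0; [apply: mulr_ge0|exact: ltW].
  apply: mulr_ge0; last exact: sqr_ge0.
  by rewrite !mulr_ge0 ?sqrtr_ge0 ?invr_ge0// ltW.
have cbound : continuous (depth_bound g eps hs).
  move=> y; rewrite (_ : depth_bound g eps hs =
      fun z => 2 * (g * Num.sqrt eps * depth_primitive hs z)).
    do 2 (apply: cvgM; first exact: cvg_cst).
    apply/differentiable_continuous/derivable1_diffP.
    by have [] := is_derive_depth_primitive hs y.
  by apply/funext => z; exact: depth_boundE.
have [hE hE0hs EhE] : exists2 y, y \in `[0, hs] & depth_bound g eps hs y = E.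
  apply: IVT; [exact: ltW|exact: continuous_subspaceT|].
  by rewrite bound0 boundhs ge_min le_max E_ge0 (ltW EltE0) !orbT.
have [hE_ge0 hE_le] : 0 <= hE /\ hE <= hs by move: hE0hs; rewrite in_itv => /andP[].
have hE_gt0 : 0 < hE.
  rewrite lt_neqAle hE_ge0 andbT; apply/eqP => hE0.
  by move: EltE0; rewrite -bound0 -EhE -hE0 ltxx.
exists hE; split; first split.
- by rewrite hE_gt0 hE_le.
- move=> y [/andP[y0 yhs] Ey].
  have [yhE|hEy|//] := ltgtP hE y.
    by have := depth_bound_decr g_gt0 eps_gt0 hE_ge0 yhE yhs; rewrite EhE -Ey ltxx.
  by have := depth_bound_decr g_gt0 eps_gt0 (ltW y0) hEy hE_le; rewrite EhE -Ey ltxx.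
- move=> x; split=> //; rewrite leNgt; apply/negP => hxE.
  have := depth_bound_decr g_gt0 eps_gt0 (h_ge0 x) hxE hE_le.
  by rewrite EhE ltNge boundE.
Qed.
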